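(* Let $\ell$ be a positive integer and let $r_i=(a_i,b_i,c_i,d_i)\in\mathbb{Z}^4$, $i=1,2,3,4$, satisfy $r_i\cdot r_j=a_ia_j+b_ib_j+c_ic_j+d_id_j=\delta_{ij}\ell$ for all $i,j\in\{1,2,3,4\}$. Let $C_\ell=\{s_1r_1+s_2r_2+s_3r_3: s_1,s_2,s_3\in[0,1]\}$ be the three-dimensional cube spanned by the first three rows. Let $D_i=\gcd(a_i,b_i,c_i,d_i)$ for $i=1,\dots,4$, and for $1\le i<j\le 3$ let $\zeta_{ij}$ be the greatest common divisor of all $2\times 2$ minors of the matrix $\begin{pmatrix} a_i & b_i & c_i & d_i\\ a_j & b_j & c_j & d_j\end{pmatrix}$. Then for all positive integers $t$, $$\#(tC_\ell\cap\mathbb{Z}^4)=L(C_\ell,t)=\ell D_4 t^3+\Delta t^2+\Delta' t+1,$$ where $\Delta=\zeta_{12}+\zeta_{13}+\zeta_{23}$ and $\Delta'=D_1+D_2+D_3$.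
   Context: $\delta_{ij}$ is the Kronecker delta. *)

(* Defs.v *)
From HB Require Import structures.
From mathcomp Require Import all_boot all_order all_algebra.
From mathcomp Require Import reals.
Set Implicit Arguments. Unset Strict Implicit. Unset Printing Implicit Defensive.
Import Order.TTheory GRing.Theory Num.Theory.
Local Open Scope ring_scope.

(* Rows r_1..r_4 of the paper are rows 0..3 of a 4x4 integer matrix. *)
Definition ridx0 : 'I_4 := inord 0.
Definition ridx1 : 'I_4 := inord 1.
Definition ridx2 : 'I_4 := inord 2.
Definition ridx3 : 'I_4 := inord 3.

Definition rowgcd (r : 'M[int]_4) (i : 'I_4) : int :=
  \big[gcdz/0]_(k < 4) r i k.

Definition minorgcd (r : 'M[int]_4) (i j : 'I_4) : int :=
  \big[gcdz/0]_(k < 4) \big[gcdz/0]_(m < 4 | (k < m)%N)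
     (r i k * r j m - r i m * r j k).

Definition in_dilated_cube (R : realType) (r : 'M[int]_4) (t : nat)
  (x : 'rV[int]_4) : Prop :=
  exists s : 'I_3 -> R,
    (forall i, 0 <= s i <= 1) /\
    forall k : 'I_4,
      (x 0 k)%:~R = t%:R * \sum_(i < 3) s i * (r (widen_ord (leqnSn 3) i) k)%:~R.

(* Main.v *)
Require Import Defs.
From HB Require Import structures.
From mathcomp Require Import all_boot all_order all_algebra.
From mathcomp Require Import reals.
From mathcomp Require Import ring lra zify.
Import Order.TTheory GRing.Theory Num.Theory.
Local Open Scope ring_scope.

(** Splitting each factor [0,1] of the cube as [0,1) + {1} partitions the closed
    cube into eight translates, by integer vectors, of the half-open
    parallelepipeds spanned by the subsets of {t r_1, t r_2, t r_3}.  The half-open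
    parallelepiped spanned by the rows of A contains as many integer points as
    the index of the row lattice in its saturation; by the Smith normal form this
    is the gcd of the maximal minors of A, i.e. the gcd of all determinants
    obtained by completing A to a square matrix.  The latter description is
    visibly invariant under unimodular changes of basis and makes the
    Cauchy-Binet formula unnecessary.  For r_1, r_2, r_3 the determinant completed
    by v is, up to sign, l (v . r_4), because |det r| = l^2. *)

(** * Gcd of the maximal minors, through completions to a square matrix *)

Lemma absz_det_unitmx n (U : 'M[int]_n) : U \in unitmx -> `|\det U|%N = 1%N.
Proof.
move=> uU; have /(congr1 absz) : \det U * \det (invmx U) = 1.
  by rewrite -det_mulmx mulmxV // det1.
by rewrite abszM => /eqP; rewrite muln_eq1 => /andP[/eqP].
Qed.

(* Expanding along the rows of V, g is the gcd of the k x k minors of A. *)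
Definition det_gcd {k m} (A : 'M[int]_(k, k + m)) (g : nat) : Prop :=
  (forall V : 'M_(m, k + m), (g %| \det (col_mx A V))%Z) /\
  exists V : 'M_(m, k + m), `|\det (col_mx A V)|%N = g.

Lemma det_gcd_uniq k m (A : 'M[int]_(k, k + m)) g h :
  det_gcd A g -> det_gcd A h -> g = h.
Proof.
move=> [gA [V gV]] [hA [W hW]]; apply/eqP; rewrite eqn_dvd.
by have := gA W; have := hA V; rewrite !dvdzE /= gV hW => -> ->.
Qed.

Lemma det_gcd_scale k m (A : 'M[int]_(k, k + m)) g t :
  det_gcd A g -> det_gcd (t%:Z *: A) (t ^ k * g)%N.
Proof.
have detE V : \det (col_mx (t%:Z *: A) V) = t%:Z ^+ k * \det (col_mx A V).
  have -> : col_mx (t%:Z *: A) V = block_mx (t%:Z)%:M 0 0 1%:M *m col_mx A V.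
    by rewrite mul_block_col !mul0mx mul1mx mul_scalar_mx addr0 add0r.
  by rewrite det_mulmx det_lblock det_scalar det1 mulr1.
move=> [gA [V gV]]; split => [W|].
  by rewrite detE dvdzE abszM abszX dvdn_mul //; have := gA W; rewrite dvdzE.
by exists V; rewrite detE abszM abszX gV.
Qed.

(* Smith normal form with the square diagonal block merged into the left factor. *)
Lemma smith_row_block k m (A : 'M[int]_(k, k + m)) :
  exists L : 'M[int]_k, exists d : 'rV[int]_k, exists U : 'M[int]_(k + m),
  [/\ L \in unitmx, U \in unitmx & A = row_mx (L *m diag_mx d) 0 *m U].
Proof.
have [L uL [U uU [d _ ->]]] := int_Smith_normal_form A.
exists L, (\row_i d`_i), U; split=> //; congr (_ *m _).
rewrite -[X in row_mx _ X](mulmx0 _ L) -mul_mx_row; congr (_ *m _).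
apply/matrixP=> i j; rewrite !mxE; case: splitP => j' ->; rewrite !mxE //.
by rewrite ltn_eqF // ltn_addr.
Qed.

(** With completing rows written as (V1, V2) U, the completed matrix is block lower triangular times
    a unimodular matrix. Its determinant is therefore, up to sign, the product of the d_i times det
    V2, and V2 = 1 attains the gcd. *)
Lemma det_gcd_smith k m (L : 'M[int]_k) d (U : 'M[int]_(k + m)) :
  L \in unitmx -> U \in unitmx ->
  det_gcd (row_mx (L *m diag_mx d) 0 *m U) (\prod_i `|d 0%R i|)%N.
Proof.
move=> uL uU; have dE : `|\det (L *m diag_mx d)|%N = (\prod_i `|d 0%R i|)%N.
  rewrite det_mulmx abszM absz_det_unitmx // mul1n det_diag.
  exact: (big_morph absz abszM absz1).
have detE V1 V2 : `|\det (col_mx (row_mx (L *m diag_mx d) 0 *m U)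
    (row_mx V1 V2 *m U))|%N = ((\prod_i `|d 0%R i|) * `|\det V2|)%N.
  rewrite -mul_col_mx -/(block_mx _ _ _ _) det_mulmx det_lblock !abszM dE.
  by rewrite (absz_det_unitmx _ _ uU) muln1.
split=> [V|].
  rewrite dvdzE -[V](mulmxKV uU) -[V *m _]hsubmxK detE.
  exact: dvdn_mulr.
by exists (row_mx 0 1%:M *m U); rewrite detE det1 muln1.
Qed.

(** Spares exhibiting a completion that attains g: the Smith form supplies an attained common
    divisor, which divides g by maximality and is divisible by g. *)
Lemma det_gcdP k m (A : 'M[int]_(k, k + m)) (g : nat) :
    (forall V : 'M_(m, k + m), (g %| \det (col_mx A V))%Z) ->
    (forall h : nat, (forall V : 'M_(m, k + m), (h %| \det (col_mx A V))%Z) ->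
      (h %| g)%N) ->
  det_gcd A g.
Proof.
move=> gA gmax; have [L [d [U [uL uU defA]]]] := smith_row_block k m A.
have [hA [V hV]] := det_gcd_smith k m L d U uL uU; rewrite -defA in hA hV.
split=> //; exists V; apply/eqP; rewrite eqn_dvd hV gmax //=.
by have := gA V; rewrite dvdzE hV.
Qed.

(** * Integer points of a half-open parallelepiped *)

Lemma int_box k (d : 'I_k -> nat) :
  exists S : seq 'rV[int]_k,
    [/\ uniq S, (forall y : 'rV[int]_k, y \in S <-> forall i, 0 <= y 0 i < (d i)%:Z)
      & size S = (\prod_i d i)%N].
Proof.
pose F (f : {dffun forall i, 'I_(d i)}) : 'rV[int]_k := \row_i (f i : nat)%:Z.
exists (map F (enum {: {dffun forall i, 'I_(d i)}})); split.
- rewrite map_inj_uniq ?enum_uniq // => f g /rowP fg; apply/ffunP=> i.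
  by have := fg i; rewrite !mxE => -[] /val_inj.
- move=> y; split=> [/mapP[f _ ->] i|y_box].
    by rewrite mxE lez_nat ltz_nat ltn_ord.
  have lt_y i : (`|y 0%R i| < d i)%N by have := y_box i; lia.
  apply/mapP; exists [ffun i => Ordinal (lt_y i)]; first by rewrite mem_enum.
  by apply/rowP=> i; rewrite mxE ffunE /= gez0_abs //; have /andP[] := y_box i.
rewrite size_map -cardE card_dep_ffun foldrE big_map big_enum /=.
by apply: eq_bigr => i _; rewrite card_ord.
Qed.

Definition half_open_pt (R : realType) {k n} (A : 'M[int]_(k, n))
    (x : 'rV[int]_n) : Prop :=
  exists2 s : 'rV[R]_k, (forall i, 0 <= s 0 i < 1)
    & map_mx intr x = s *m map_mx intr A.

Lemma map_intr_inj (R : realType) m n :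
  injective (map_mx (intr : int -> R) : 'M_(m, n) -> 'M_(m, n)).
Proof.
move=> A B /matrixP AB; apply/matrixP=> i j; apply: (@intr_inj R).
by have := AB i j; rewrite !mxE.
Qed.

(* With A = (L D, 0) U, the box prod_i [0, |d_i|) of residues y modulo the row
   lattice of D is mapped to the fractional part of y (L D)^-1, read in the basis A. *)
Lemma half_open_count (R : realType) k m (A : 'M[int]_(k, k + m)) g :
    (forall u : 'rV[int]_k, u *m A = 0 -> u = 0) -> det_gcd A g ->
  exists S : seq 'rV[int]_(k + m),
    [/\ uniq S, (forall x, x \in S <-> half_open_pt R A x) & size S = g].
Proof.
move=> A_inj Ag; have [L [d [U [uL uU defA]]]] := smith_row_block k m A.
(* If d_i = 0, the row e_i L^-1 is killed by A, hence zero, which forces e_i = 0. *)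
have d_neq0 i : d 0 i != 0.
  apply/eqP=> di0; have : (delta_mx 0 i : 'rV_k) *m invmx L *m A = 0.
    rewrite defA mulmxA mul_mx_row mulmx0 (mulmxA _ L) mulmxKV // mul_mx_diag.
    have -> : (\matrix_(i0, j) (delta_mx 0 i i0 j * d 0 j)) = 0 :> 'rV[int]_k.
      apply/rowP=> j; rewrite !mxE eqxx /=.
      by case: eqP => [->|_]; rewrite ?di0 ?mulr0 ?mul0r.
    by rewrite row_mx0 mul0mx.
  move/A_inj/(canRL (mulmxKV uL)); rewrite mul0mx => /rowP/(_ i); rewrite !mxE !eqxx /=; lia.
set B := L *m diag_mx d in defA.
have -> : g = (\prod_i `|d 0%R i|)%N.
  by apply: (det_gcd_uniq _ _ _ _ _ Ag); rewrite defA; apply: det_gcd_smith.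
have BE : B = L *m diag_mx d by [].
clearbody B.
pose toR p q := map_mx (intr : int -> R) : 'M_(p, q) -> 'M_(p, q).
have uB : toR _ _ B \in unitmx.
  rewrite unitmxE unitfE det_map_mx intr_eq0 BE det_mulmx mulf_neq0 //.
    by rewrite -absz_eq0 absz_det_unitmx.
  by rewrite det_diag; apply/prodf_neq0.
pose fl (y : 'rV[int]_k) : 'rV[int]_k :=
  map_mx Num.floor (toR _ _ y *m invmx (toR _ _ B)).
pose phi (y : 'rV[int]_k) := row_mx (y - fl y *m B) 0 *m U : 'rV[int]_(k + m).
have [box [box_uniq boxP size_box]] := int_box k (fun i => `|d 0%R i|%N).
exists (map phi box); split; last by rewrite size_map.
- rewrite map_inj_in_uniq // => y y' /boxP yb /boxP y'b /(can_inj (mulmxK uU)).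
  case/eq_row_mx=> eqB _.
  have : y - y' = (fl y - fl y') *m B.
    by rewrite mulmxBl -[y in LHS](subrK (fl y *m B)) eqB addrC !addrA addNr add0r addrC.
  (* As B = L D, the i-th entry of y - y' is a multiple c d_i; both entries lie in [0, |d_i|), so c
     = 0. *)
  rewrite BE mulmxA mul_mx_diag => /rowP E; apply/rowP=> i.
  have := E i; rewrite !mxE; set c := \sum_j _ => cE.
  have := yb i; have := y'b i; move: cE.
  move: (d 0 i) (y 0 i) (y' 0 i) c => e a b c cE b_itv a_itv.
  suff c0 : c = 0 by move: cE; rewrite c0 mul0r; lia.
  have : `|c * e| < `|e| by rewrite -cE; lia.
  rewrite normrM; nia.
- move=> x; split=> [/mapP[y _ ->]|[s s01 xE]].
    set s0 := toR _ _ y *m invmx (toR _ _ B).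
    exists (s0 - toR _ _ (fl y)) => [i|].
      rewrite !mxE -/s0; have /andP[] := floor_itv (s0 0 i).
      by rewrite mxE intrD; lra.
    rewrite defA /phi !map_mxM !map_row_mx !map_mx0 mulmxA mul_mx_row mulmx0.
    congr (row_mx _ _ *m _); rewrite map_mxB mulmxBl mulmxKV //.
    by rewrite map_mxM.
  have [w xw] : exists w, x = w *m U by exists (x *m invmx U); rewrite mulmxKV.
  have uUR : toR _ _ U \in unitmx.
    by rewrite unitmxE unitfE det_map_mx intr_eq0 -absz_eq0 absz_det_unitmx.
  move: xE; rewrite xw defA !map_mxM mulmxA => /(can_inj (mulmxK uUR)).
  rewrite -[w]hsubmxK !map_row_mx map_mx0 mul_mx_row mulmx0.
  case/eq_row_mx; move: (lsubmx w) => w1 w1E.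
  rewrite -(map_mx0 (intr : int -> R)) => /map_intr_inj w20.
  (* The preimage of x is the entrywise Euclidean remainder y of w1 by d. Since y B^-1 = s - q L^-1
     with s in [0,1) and q L^-1 integral, its floor is - q L^-1, and [phi] sends y back to x. *)
  pose q : 'rV[int]_k := \row_i (w1 0%R i %/ d 0%R i)%Z.
  pose y := w1 - q *m diag_mx d.
  have flE : fl y = - (q *m invmx L).
    rewrite /fl; have -> : toR _ _ y *m invmx (toR _ _ B)
        = s - toR _ _ (q *m invmx L).
      apply: (canLR (mulmxK uB)); rewrite mulmxBl /toR -map_mxM BE mulmxA mulmxKV //.
      by rewrite map_mxB w1E BE.
    apply/rowP=> i; rewrite !mxE; apply: floor_def.
    move: (s01 i); set c := \sum_j _.
    by rewrite intrD intrN => /andP[]; lra.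
  apply/mapP; exists y.
    apply/boxP=> i; rewrite /y mul_mx_diag !mxE.
    by rewrite -/(modz (w1 0 i) (d 0 i)) modz_ge0 //= ltz_mod.
  rewrite /phi w20 flE mulNmx opprK; congr (row_mx _ _ *m _).
  by rewrite /y BE mulmxA mulmxKV // subrK.
Qed.

(** * Explicit gcds of minors for zero, one and two rows *)

Lemma biggcdz_nat (I : finType) (P : pred I) (F : I -> int) :
  \big[gcdz/0]_(i | P i) F i = (\big[gcdn/0]_(i | P i) `|F i|)%N%:Z.
Proof. by elim/big_rec2: _ => // i x y _ ->. Qed.

Lemma dvdz_biggcdP (I : finType) (P : pred I) (F : I -> int) (d : int) :
  reflect (forall i, P i -> (d %| F i)%Z) (d %| \big[gcdz/0]_(i | P i) F i)%Z.
Proof.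
rewrite biggcdz_nat dvdzE; apply: (iffP (dvdn_biggcdP _ _ _)) => dF i Pi.
  by rewrite dvdzE dF.
by have := dF i Pi; rewrite dvdzE.
Qed.

Lemma biggcdz_inf (I : finType) (i : I) (P : pred I) (F : I -> int) :
  P i -> (\big[gcdz/0]_(j | P j) F j %| F i)%Z.
Proof. by move: i; apply/dvdz_biggcdP. Qed.

(** Multiplication by c distributes over gcds. This serves the maximality half of [det_gcdP], with c
    equal to 1 or to a power of l. *)
Lemma dvdn_mul_biggcd (I : finType) (F : I -> int) (c h : nat) :
    (forall i, (h %| c%:Z * F i)%Z) ->
  (h %| c * `|\big[gcdz/0%R]_i F i|)%N.
Proof.
move=> hF; rewrite biggcdz_nat absz_nat.
rewrite (big_morph (muln c) (muln_gcdr c) (muln0 c)).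
by apply/dvdn_biggcdP=> i _; have := hF i; rewrite dvdzE abszM.
Qed.

(* Grouped as the Laplace expansion along the first two rows. *)
Lemma det_mx44 (K : comNzRingType) (A : 'M[K]_4) :
  let a i j := A (inord i) (inord j) in
  \det A =
    (a 0 0 * a 1 1 - a 0 1 * a 1 0) * (a 2 2 * a 3 3 - a 2 3 * a 3 2)
  - (a 0 0 * a 1 2 - a 0 2 * a 1 0) * (a 2 1 * a 3 3 - a 2 3 * a 3 1)
  + (a 0 0 * a 1 3 - a 0 3 * a 1 0) * (a 2 1 * a 3 2 - a 2 2 * a 3 1)
  + (a 0 1 * a 1 2 - a 0 2 * a 1 1) * (a 2 0 * a 3 3 - a 2 3 * a 3 0)
  - (a 0 1 * a 1 3 - a 0 3 * a 1 1) * (a 2 0 * a 3 2 - a 2 2 * a 3 0)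
  + (a 0 2 * a 1 3 - a 0 3 * a 1 2) * (a 2 0 * a 3 1 - a 2 1 * a 3 0).
Proof.
move=> a.
have aE i j : A i j = a i j by rewrite /a !inord_val.
rewrite (expand_det_row _ ord0) !big_ord_recl big_ord0 /cofactor.
do 2 rewrite !(expand_det_row (_ : 'M_(_.+1)) ord0) !big_ord_recl !big_ord0 /cofactor.
rewrite !det_mx11 !mxE !aE /= /bump /=.
ring.
Qed.

(** The empty matrix completed by the identity has determinant 1. This case counts the vertex of the
    cube. *)
Lemma det_gcd0 m (A : 'M[int]_(0, 0 + m)) : det_gcd A 1.
Proof.
apply: det_gcdP => [V|h /(_ 1%:M)]; first by rewrite dvdzE dvd1n.
have -> : col_mx A 1%:M = 1%:M :> 'M_m.
  by apply/matrixP=> i j; rewrite mxE; case: splitP => [[]|i' /val_inj ->].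
by rewrite det1 dvdzE.
Qed.

(** Standard basis rows with indices listed in [p]: completing by them collapses the determinant to
    a single signed minor of the given rows. *)
Definition unit_rows m (p : seq nat) : 'M[int]_(m, 4) :=
  \matrix_(i, j) (nth 0%N p i == j)%:R.

(** Expansion along the given row shows that the gcd divides every completion; completions by unit
    rows recover each entry. *)
Lemma det_gcd1 (A : 'M[int]_(1, 1 + 3)) :
  det_gcd A `|\big[gcdz/0%R]_k A 0%R k|%N.
Proof.
have AE V c : col_mx A V (inord 0) c = A 0 c.
  by rewrite -(col_mxEu A V); congr (col_mx A V _ _); apply/val_inj; rewrite /= inordK.
apply: det_gcdP => [V|h hA].
  rewrite dvdzE /= -dvdzE (expand_det_row _ (inord 0)).
  apply: rpred_sum => k _; rewrite dvdz_mulr // AE; exact: biggcdz_inf.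
rewrite -[X in (_ %| X)%N]mul1n; apply: dvdn_mul_biggcd => k; rewrite mul1r.
have VE p (i c : nat) : (i < 3)%N -> (c < 4)%N ->
    col_mx A (unit_rows 3 p) (inord i.+1) (inord c) = (nth 0%N p i == c)%:R.
  move=> i3 c4; have -> : (inord i.+1 : 'I_4) = rshift 1 (Ordinal i3).
    by apply/val_inj; rewrite /= inordK.
  by rewrite col_mxEd mxE inordK.
have hE p := hA (unit_rows 3 p).
rewrite -[k]inord_val; case: k => -[|[|[|[|//]]]] _ /=.
(* Each list is ordered so that k followed by it is an even permutation of 0, 1, 2, 3; the
   determinant is then the entry itself, with sign +. *)
- by apply: etrans (hE [:: 1; 2; 3]%N); rewrite det_mx44 !AE !VE //=; congr dvdz; ring.
- by apply: etrans (hE [:: 0; 3; 2]%N); rewrite det_mx44 !AE !VE //=; congr dvdz; ring.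
- by apply: etrans (hE [:: 0; 1; 3]%N); rewrite det_mx44 !AE !VE //=; congr dvdz; ring.
- by apply: etrans (hE [:: 0; 2; 1]%N); rewrite det_mx44 !AE !VE //=; congr dvdz; ring.
Qed.

(** Laplace expansion along the two given rows yields divisibility; completing by two unit rows,
    again in an order giving an even permutation, isolates each minor. *)
Lemma det_gcd2 (A : 'M[int]_(2, 2 + 2)) :
  det_gcd A `|\big[gcdz/0%R]_(k < 4) \big[gcdz/0%R]_(m < 4 | (k < m)%N)
    (A 0%R k * A 1%R m - A 0%R m * A 1%R k)%R|%N.
Proof.
have A0E V c : col_mx A V (inord 0) c = A 0 c.
  by rewrite -(col_mxEu A V); congr (col_mx A V _ _); apply/val_inj; rewrite /= inordK.
have A1E V c : col_mx A V (inord 1) c = A 1 c.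
  by rewrite -(col_mxEu A V); congr (col_mx A V _ _); apply/val_inj; rewrite /= inordK.
apply: det_gcdP => [V|h hA].
  rewrite dvdzE /= -dvdzE; set g := \big[gcdz/0]_(k < 4) _.
  have gA (k m : nat) : (k < m)%N -> (m < 4)%N ->
      (g %| (A 0 (inord k) * A 1 (inord m) - A 0 (inord m) * A 1 (inord k))%R)%Z.
    move=> km m4; have k4 := ltn_trans km m4.
    apply: dvdz_trans (biggcdz_inf _ (inord k) _ _ _) _ => //.
    by apply: (biggcdz_inf _ (inord m)); rewrite !inordK.
  rewrite det_mx44 !A0E !A1E.
  apply: rpredD; [apply: rpredB; [apply: rpredD; [apply: rpredD; [apply: rpredB|]|]|]|];
    by rewrite dvdz_mulr // gA.
rewrite -[X in (_ %| X)%N]mul1n; apply: dvdn_mul_biggcd => k; rewrite mul1r.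
apply/dvdz_biggcdP => m km.
have VE p (i c : nat) : (i < 2)%N -> (c < 4)%N ->
    col_mx A (unit_rows 2 p) (inord i.+2) (inord c) = (nth 0%N p i == c)%:R.
  move=> i2 c4; have -> : (inord i.+2 : 'I_4) = rshift 2 (Ordinal i2).
    by apply/val_inj; rewrite /= inordK.
  by rewrite col_mxEd mxE inordK.
have hE p := hA (unit_rows 2 p).
rewrite -[k]inord_val -[m]inord_val.
case: k m km => -[|[|[|[|//]]]] ? [] [|[|[|[|//]]]] ? //= _.
- by apply: etrans (hE [:: 2; 3]%N); rewrite det_mx44 !A0E !A1E !VE //=; congr dvdz; ring.
- by apply: etrans (hE [:: 3; 1]%N); rewrite det_mx44 !A0E !A1E !VE //=; congr dvdz; ring.
- by apply: etrans (hE [:: 1; 2]%N); rewrite det_mx44 !A0E !A1E !VE //=; congr dvdz; ring.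
- by apply: etrans (hE [:: 0; 3]%N); rewrite det_mx44 !A0E !A1E !VE //=; congr dvdz; ring.
- by apply: etrans (hE [:: 2; 0]%N); rewrite det_mx44 !A0E !A1E !VE //=; congr dvdz; ring.
- by apply: etrans (hE [:: 0; 1]%N); rewrite det_mx44 !A0E !A1E !VE //=; congr dvdz; ring.
Qed.

(** * Orthogonal rows of equal norm *)

(** Multiplying (N; V) by the transpose of (N; v) gives a block lower triangular matrix with
    diagonal blocks l I and V v^T, of determinant l^k (V v^T). Dividing by |det (N; v)| =
    l^((k+1)/2), an integral power as k is odd, leaves l^((k-1)/2) |V v^T|; the choices V = e_j run
    through the entries of v. *)
Lemma det_gcd_orthogonal k (l : nat) (N : 'M[int]_(k, k + 1)) (v : 'rV_(k + 1)) :
    (0 < l)%N -> odd k -> col_mx N v *m (col_mx N v)^T = (l%:Z)%:M ->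
  det_gcd N (l ^ k./2 * `|\big[gcdz/0%R]_j v 0%R j|)%N.
Proof.
move=> l_gt0 k_odd rrT.
have /eq_block_mx[NN Nv _ _] : block_mx (N *m N^T) (N *m v^T) (v *m N^T) (v *m v^T)
    = block_mx (l%:Z)%:M 0 0 (l%:Z)%:M.
  by rewrite -mul_col_row -tr_col_mx rrT scalar_mx_block.
set q := k./2; have kE : k = (q.*2).+1 by rewrite -[LHS]odd_double_half k_odd.
have detr : `|\det (col_mx N v)|%N = (l ^ q.+1)%N.
  have /(congr1 absz) : \det (col_mx N v) ^+ 2 = l%:Z ^+ (q.+1 * 2).
    rewrite expr2 -{2}det_tr -det_mulmx rrT det_scalar; congr (_ ^+ _); lia.
  rewrite !abszX /= expnM => /eqP.
  by rewrite eqn_exp2r // => /eqP.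
have detE V : `|\det (col_mx N V)|%N = (l ^ q * `|(V *m v^T) 0%R 0%R|)%N.
  have /(congr1 absz) : \det (col_mx N V) * \det (col_mx N v)
      = l%:Z ^+ (q + q.+1) * (V *m v^T) 0 0.
    rewrite -[\det (col_mx N v)]det_tr -det_mulmx tr_col_mx mul_col_row NN Nv.
    rewrite det_lblock det_scalar det_mx11; congr (_ ^+ _ * _); lia.
  rewrite !abszM abszX detr expnD mulnAC /= => /eqP.
  by rewrite eqn_pmul2r ?expn_gt0 ?l_gt0 // => /eqP.
apply: det_gcdP => [V|h hN].
  rewrite dvdzE detE dvdn_mul //= -[X in (X %| _)%N]absz_nat -dvdzE.
  rewrite mxE rpred_sum // => j _; rewrite mxE dvdz_mull // dvdzE /= -dvdzE.
  exact: biggcdz_inf.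
apply: dvdn_mul_biggcd => j; have := hN (delta_mx 0 j).
rewrite !dvdzE detE abszM /= -rowE.
by rewrite !mxE.
Qed.

Lemma rowsub_orthogonal (K : pzRingType) k n N (M : 'M[K]_(n, N)) (f : 'I_k -> 'I_n) c :
  injective f -> M *m M^T = c%:M -> rowsub f M *m (rowsub f M)^T = c%:M.
Proof.
move=> f_inj /matrixP MM; apply/matrixP=> i j.
have := MM (f i) (f j); rewrite !mxE (inj_eq f_inj) => <-.
by apply: eq_bigr => p _; rewrite !mxE.
Qed.

(** Multiply u M = 0 by M^T to get c u = 0. Used over the integers for the independence of the rows
    and over the reals for the uniqueness of cube coordinates. *)
Lemma orthogonal_mulmx_eq0 (K : idomainType) n N (M : 'M[K]_(n, N)) c (u : 'rV_n) :
  c != 0 -> M *m M^T = c%:M -> u *m M = 0 -> u = 0.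
Proof.
move=> c0 MM uM; have /rowP cu : c *: u = 0 by rewrite -mul_mx_scalar -MM mulmxA uM mul0mx.
by apply/rowP=> i; have /eqP := cu i; rewrite !mxE mulf_eq0 (negPf c0) => /eqP.
Qed.

(** * Faces of the cube as translated half-open parallelepipeds *)

Definition face_pt (R : realType) {n N} (M : 'M[int]_(n, N)) (b : pred 'I_n)
    (x : 'rV[int]_N) : Prop :=
  exists2 s : 'rV[R]_n, (forall i, if b i then 0 <= s 0 i < 1 else s 0 i == 1)
    & map_mx intr x = s *m map_mx intr M.

(** The coordinates fixed at 1 contribute exactly the integer vector [c]; the free ones, enumerated
    by [f], give the half-open parallelepiped. *)
Lemma face_pt_half_open (R : realType) k n N (M : 'M[int]_(n, N))
    (f : 'I_k -> 'I_n) (b : pred 'I_n) (x : 'rV[int]_N) :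
    injective f -> b =i codom f ->
  face_pt R M b (x + \sum_(i | ~~ b i) row i M) <-> half_open_pt R (rowsub f M) x.
Proof.
move=> f_inj bE; set c := \sum_(i | _) _.
have bf j : b (f j) by rewrite -[b _]/(f j \in b) bE codom_f.
have splitM (s : 'rV[R]_n) : (forall i, ~~ b i -> s 0 i = 1) ->
    s *m map_mx intr M = colsub f s *m map_mx intr (rowsub f M) + map_mx intr c.
  move=> s1; rewrite !mulmx_sum_row (bigID b) /=; congr (_ + _).
    rewrite (eq_bigl (mem (codom f))) // -big_uniq; last exact/injectiveP.
    rewrite big_image; apply: eq_bigr => j _.
    by rewrite mxE; congr (_ *: _); apply/rowP=> p; rewrite !mxE.
  rewrite /c raddf_sum; apply: eq_bigr => i /s1 ->.
  by rewrite scale1r /= map_row.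
split=> [[s s_itv]|[s s_itv xE]].
  rewrite map_mxD splitM => [/addIr xE|i bi]; last by have := s_itv i; rewrite (negPf bi) => /eqP.
  by exists (colsub f s) => // j; have := s_itv (f j); rewrite mxE bf.
(* [s'] carries s along [f] and takes the value 1 off its image; injectivity of [f] makes the picked
   index unique. *)
pose s' : 'rV[R]_n := \row_i if [pick j | f j == i] is Some j then s 0 j else 1.
have s'f j : s' 0 (f j) = s 0 j.
  by rewrite mxE; case: pickP => [j' /eqP/f_inj ->|/(_ j)] //; rewrite eqxx.
have s'1 i : ~~ b i -> s' 0 i = 1.
  by rewrite mxE; case: pickP => // j /eqP <-; rewrite bf.
exists s' => [i|].
  case: ifP => [|/negbT/s'1 ->//]; rewrite -[b i]/(i \in b) bE => /codomP[j ->].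
  by rewrite s'f.
rewrite splitM // map_mxD xE; congr (_ *m _ + _).
by apply/rowP=> j; rewrite [RHS]mxE s'f.
Qed.

(** Translation by an integer vector preserves the count, and scaling the k free rows by t
    multiplies the gcd of their maximal minors by t^k. *)
Lemma face_count (R : realType) k m n (M : 'M[int]_(n, k + m)) (l g t : nat)
    (f : 'I_k -> 'I_n) (b : pred 'I_n) :
    (0 < l)%N -> (0 < t)%N -> M *m M^T = (l%:Z)%:M ->
    injective f -> b =i codom f -> det_gcd (rowsub f M) g ->
  exists S : seq 'rV[int]_(k + m),
    [/\ uniq S, (forall x, x \in S <-> face_pt R (t%:Z *: M) b x)
      & size S = (t ^ k * g)%N].
Proof.
move=> l_gt0 t_gt0 MM f_inj bE gM.
have [|S [uS SP size_S]] := half_open_count R _ _ (t%:Z *: rowsub f M) _ _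
  (det_gcd_scale _ _ _ _ t gM).
  move=> u; apply: (orthogonal_mulmx_eq0 _ _ _ _ (t%:Z * t%:Z * l%:Z)); first by lia.
  rewrite linearZ /= -scalemxAl -scalemxAr scalerA.
  by rewrite (rowsub_orthogonal _ _ _ _ _ _ _ f_inj MM) scale_scalar_mx.
set c := \sum_(i | ~~ b i) row i (t%:Z *: M).
exists (map (+%R^~ c) S); split; last by rewrite size_map.
  by rewrite map_inj_uniq //; apply: addIr.
move=> x; rewrite -[x](subrK c) (mem_map (addIr c)).
have tE : rowsub f (t%:Z *: M) = t%:Z *: rowsub f M.
  by apply/matrixP=> i j; rewrite !mxE.
by rewrite SP -tE; apply: iff_sym; apply: face_pt_half_open.
Qed.

(* [true] marks a half-open coordinate, [false] a coordinate equal to 1. *)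
Definition face_pred (b : bool * bool * bool) : pred 'I_3 :=
  fun i => nth false [:: b.1.1; b.1.2; b.2] i.

Lemma face_pred_inj b b' : face_pred b =1 face_pred b' -> b = b'.
Proof.
case: b b' => [[b0 b1] b2] [[c0 c1] c2] E.
by have := (E (inord 0), E (inord 1), E (inord 2)); rewrite /face_pred !inordK //= => -[[-> ->] ->].
Qed.

Lemma codom_pair (i j k : 'I_3) :
  (k \in codom (fun o : 'I_2 => if o == 0 then i else j)) = (k == i) || (k == j).
Proof.
apply/codomP/orP=> [[o ->]|[/eqP->|/eqP->]]; first by case: ifP; rewrite eqxx; auto.
  by exists 0.
by exists 1.
Qed.

(** * Summation over the eight faces *)

Theorem theorem2p15 (R : realType) (l : nat) (r : 'M[int]_4) :
  (0 < l)%N ->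
  r *m r^T = (l%:Z)%:M ->
  forall t : nat, (0 < t)%N ->
  exists S : seq 'rV[int]_4,
    [/\ uniq S,
        (forall x : 'rV[int]_4, x \in S <-> in_dilated_cube R r t x) &
        (size S)%:Z =
          l%:Z * rowgcd r ridx3 * t%:Z ^+ 3
          + (minorgcd r ridx0 ridx1 + minorgcd r ridx0 ridx2 + minorgcd r ridx1 ridx2) * t%:Z ^+ 2
          + (rowgcd r ridx0 + rowgcd r ridx1 + rowgcd r ridx2) * t%:Z + 1].
Proof.
move=> l_gt0 rr t t_gt0.
pose w := widen_ord (leqnSn 3); pose N := rowsub w r : 'M[int]_(3, 4).
have NN : N *m N^T = (l%:Z)%:M.
  by apply: rowsub_orthogonal rr => i j /(congr1 val) ij; apply/val_inj.
have wE (i : 'I_3) (j : 'I_4) : i = j :> nat -> w i = j by move=> ij; apply/val_inj.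
pose i0 : 'I_3 := inord 0; pose i1 : 'I_3 := inord 1; pose i2 : 'I_3 := inord 2.
have w0 : w i0 = ridx0 by apply: wE; rewrite !inordK.
have w1 : w i1 = ridx1 by apply: wE; rewrite !inordK.
have w2 : w i2 = ridx2 by apply: wE; rewrite !inordK.
(* A face with k free coordinates contributes t^k times the gcd of the k x k minors of its free
   rows. *)
pose cnt (b : bool * bool * bool) : int := match b with
  | (true, true, true) => t%:Z ^+ 3 * (l%:Z * rowgcd r ridx3)
  | (true, true, false) => t%:Z ^+ 2 * minorgcd r ridx0 ridx1
  | (true, false, true) => t%:Z ^+ 2 * minorgcd r ridx0 ridx2
  | (false, true, true) => t%:Z ^+ 2 * minorgcd r ridx1 ridx2
  | (true, false, false) => t%:Z * rowgcd r ridx0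
  | (false, true, false) => t%:Z * rowgcd r ridx1
  | (false, false, true) => t%:Z * rowgcd r ridx2
  | (false, false, false) => 1 end.
have rowgcd_abs i : `|rowgcd r i|%N = rowgcd r i :> int.
  by rewrite /rowgcd biggcdz_nat.
have minorgcd_abs i j : `|minorgcd r i j|%N = minorgcd r i j :> int.
  by rewrite /minorgcd biggcdz_nat.
have edge (i : 'I_3) b : face_pred b =i pred1 i ->
    exists S : seq 'rV[int]_4, [/\ uniq S,
      (forall x, x \in S <-> face_pt R (t%:Z *: N) (face_pred b) x)
      & (size S)%:Z = t%:Z * rowgcd r (w i)].
  move=> bE; have fE : face_pred b =i codom (fun _ : 'I_1 => i).
    move=> j; rewrite bE inE; apply/eqP/codomP => [->|[_ ->] //]; by exists 0.
  have gN := det_gcd1 (rowsub (fun _ : 'I_1 => i) N).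
  have [|S [uS SP size_S]] := face_count R 1 3 3 N l _ t _ _ l_gt0 t_gt0 NN _ fE gN.
    by move=> a a' _; rewrite !ord1.
  exists S; split=> //; rewrite size_S PoszM expn1 -rowgcd_abs.
  by congr (_ * `| _ |%N%:Z); apply: eq_bigr => k _; rewrite !mxE.
have facet (i j : 'I_3) b : i != j -> face_pred b =i pred2 i j ->
    exists S : seq 'rV[int]_4, [/\ uniq S,
      (forall x, x \in S <-> face_pt R (t%:Z *: N) (face_pred b) x)
      & (size S)%:Z = t%:Z ^+ 2 * minorgcd r (w i) (w j)].
  move=> ij bE; pose f (o : 'I_2) := if o == 0 then i else j.
  have fE : face_pred b =i codom f by move=> k; rewrite bE codom_pair.
  have gN := det_gcd2 (rowsub f N).
  have [|S [uS SP size_S]] := face_count R 2 2 3 N l _ t _ _ l_gt0 t_gt0 NN _ fE gN.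
    move=> [[|[|//]] ?] [[|[|//]] ?] //=; rewrite /f /= => E; apply/val_inj => //=.
      by case/eqP: ij.
    by case/eqP: ij.
  exists S; split=> //; rewrite size_S PoszM -minorgcd_abs.
  congr (_ * `| _ |%N%:Z); apply: eq_bigr => k _; apply: eq_bigr => p _.
  by rewrite !mxE.
have solid : exists S : seq 'rV[int]_4, [/\ uniq S,
      (forall x, x \in S <-> face_pt R (t%:Z *: N) (face_pred (true, true, true)) x)
      & (size S)%:Z = t%:Z ^+ 3 * (l%:Z * rowgcd r ridx3)].
  have rE : col_mx N (row ridx3 r) = r.
    apply/matrixP=> i j; rewrite mxE; case: splitP => [i' iE|i' iE]; rewrite !mxE.
      by congr (r _ _); apply: wE.
    by congr (r _ _); apply/val_inj; rewrite /= iE ord1 inordK.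
  (* For k = 3 the factor [l ^ k./2] is l, giving l D_4. *)
  have gN := det_gcd_orthogonal 3 l N (row ridx3 r) l_gt0 isT.
  rewrite rE in gN; have {}gN := gN rr.
  have idN : rowsub id N = N by apply/matrixP=> i j; rewrite mxE.
  rewrite -idN in gN.
  have [//||S [uS SP size_S]] :=
    face_count R 3 1 3 N l _ t id (face_pred (true, true, true)) l_gt0 t_gt0 NN _ _ gN.
    move=> i; rewrite codom_f; by case: i => -[|[|[|]]].
  exists S; split=> //; rewrite size_S !PoszM -rowgcd_abs.
  by congr (_ * (_ * `| _ |%N%:Z)); apply: eq_bigr => k _; rewrite mxE.
(* The face without free coordinates is the single point t (r_1 + r_2 + r_3). *)
have vertex : exists S : seq 'rV[int]_4, [/\ uniq S,
      (forall x, x \in S <-> face_pt R (t%:Z *: N) (face_pred (false, false, false)) x)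
      & (size S)%:Z = 1].
  pose f (o : 'I_0) : 'I_3 := 0.
  have [||S [uS SP size_S]] := face_count R 0 4 3 N l _ t f
    (face_pred (false, false, false)) l_gt0 t_gt0 NN _ _ (det_gcd0 4 _).
  - by case.
  - move=> i; have -> : (i \in codom f) = false by apply/negP=> /codomP[[]].
    by case: i => -[|[|[|]]].
  by exists S; split=> //; rewrite size_S.
have faces (b : bool * bool * bool) : exists S : seq 'rV[int]_4, [/\ uniq S,
      (forall x, x \in S <-> face_pt R (t%:Z *: N) (face_pred b) x)
      & (size S)%:Z = cnt b].
  case: b => [[[] []] []] //=; rewrite -?w0 -?w1 -?w2.
  - by apply: facet; rewrite -?val_eqE /= ?inordK // => -[[|[|[|]]] ?] //; rewrite !inE -!val_eqE /= !inordK.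
  - by apply: facet; rewrite -?val_eqE /= ?inordK // => -[[|[|[|]]] ?] //; rewrite !inE -!val_eqE /= !inordK.
  - by apply: edge => -[[|[|[|]]] ?] //; rewrite !inE -!val_eqE /= !inordK.
  - by apply: facet; rewrite -?val_eqE /= ?inordK // => -[[|[|[|]]] ?] //; rewrite !inE -!val_eqE /= !inordK.
  - by apply: edge => -[[|[|[|]]] ?] //; rewrite !inE -!val_eqE /= !inordK.
  - by apply: edge => -[[|[|[|]]] ?] //; rewrite !inE -!val_eqE /= !inordK.
have [F FP] := fin_all_exists faces.
pose bs := [seq (p, c) | p <- [seq (a, b) | a <- [:: true; false], b <- [:: true; false]],
                        c <- [:: true; false]].
exists [seq x | b <- bs, x <- F b]; split.
- apply: allpairs_uniq_dep => // [b _|p q]; first by have [] := FP b.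
  move=> /allpairsPdep[b [x [_ xF ->]]] /allpairsPdep[c [y [_ yF ->]]] /= xy.
  subst y; suff bc : b = c by subst c.
  have [_ /(_ x)[/(_ xF) [s s_itv xs] _] _] := FP b.
  have [_ /(_ x)[/(_ yF) [s' s'_itv xs'] _] _] := FP c.
  (* Disjointness of the faces: the real coordinates of a common point are unique because the rows
     of t N are orthogonal and nonzero, and a coordinate cannot be both below 1 and equal to 1. *)
  have ss' : s = s'.
    apply/eqP; rewrite -subr_eq0; apply/eqP.
    apply: (orthogonal_mulmx_eq0 _ _ _ (map_mx intr (t%:Z *: N)) (t%:Z * t%:Z * l%:Z)%:~R).
    - by rewrite intr_eq0; lia.
    - rewrite map_trmx -map_mxM linearZ /= -scalemxAl -scalemxAr scalerA NN.
      by rewrite scale_scalar_mx map_scalar_mx.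
    - by rewrite mulmxBl -xs -xs' subrr.
  apply: face_pred_inj => i; have := s_itv i; have := s'_itv i; rewrite -ss'.
  case: ifP => _; case: ifP => _ //; first by move=> /[swap] /eqP ->; rewrite ltxx andbF.
  by move=> /eqP ->; rewrite ltxx andbF.
- move=> x; split=> [/allpairsPdep[b [y [_ yF ->]]]|[s [s_itv xE]]].
    have [_ /(_ y)[/(_ yF) [s s_itv ys] _] _] := FP b.
    exists (fun i => s 0 i); split=> [i|k].
      by have := s_itv i; case: ifP => _ => [/andP[-> /ltW]|/eqP->] //; rewrite ler01 lexx.
    move/rowP/(_ k): ys; rewrite !mxE => ->; rewrite mulr_sumr.
    by apply: eq_bigr => i _; rewrite !mxE intrM mulrCA.
  (* The face containing x is read off from the coordinates strictly below 1; the others are equal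
     to 1. *)
  pose b := (s i0 < 1, s i1 < 1, s i2 < 1).
  apply/allpairsPdep; exists b, x; split=> //.
    by rewrite /b; do 3 case: (_ < 1).
  have [_ -> _] := FP b; exists (\row_i s i) => [i|].
    have -> : face_pred b i = (s i < 1).
      rewrite /face_pred /b -[i in RHS]inord_val.
      by case: i => -[|[|[|]]].
    by rewrite mxE; have /andP[-> s1] := s_itv i; case: ltgtP s1.
  apply/rowP=> k; rewrite !mxE xE mulr_sumr.
  by apply: eq_bigr => i _; rewrite !mxE intrM mulrCA.
have sizeF b : (size (F b))%:Z = cnt b by have [] := FP b.
rewrite size_allpairs_dep /= !PoszD !sizeF /=; ring.
Qed.
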